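(* Let $k$ be a field of characteristic zero, let $J$ be an ideal of $k[x_1,\dots,x_n]$ contained in the ideal generated by $x_1,\dots,x_n$, and suppose that $A:=k[x_1,\dots,x_n]/J$ is a local Artinian Gorenstein algebra, with socle degree $\eta$. Let $\mathrm{e}_1,\dots,\mathrm{e}_n$ be the elements of $A$ represented by $x_1,\dots,x_n$, respectively. Let $\rho:A\to k$ be a linear form whose kernel is complementary to $\mathrm{Soc}(A)$, and set $$R(x_1,\dots,x_n):=\sum_{j=0}^{\eta}\frac{1}{j!}\,\rho\left((x_1\mathrm{e}_1+\dots+x_n\mathrm{e}_n)^j\right)\in k[x_1,\dots,x_n].$$ Then the polynomial $R$ is an inverse system for $A$, i.e. $\mathrm{Ann}(R)=J$.
   Context: In the definition of $R$, the power $(x_1\mathrm{e}_1+\dots+x_n\mathrm{e}_n)^j$ is expanded in $A[x_1,\dots,x_n]$ and $\rho$ is applied to the coefficients. For a local Artinian $k$-algebra $A$ with maximal ideal $\mathfrak{m}$ (here generated by $\mathrm{e}_1,\dots,\mathrm{e}_n$), the socle is $\mathrm{Soc}(A)=\{a\in A: a\,\mathfrak{m}=0\}$; $A$ is Gorenstein if $\mathrm{Soc}(A)$ is one-dimensional over $k$; the socle degree $\eta$ is the largest integer with $\mathfrak{m}^{\eta}\neq0$. For $g\in k[x_1,\dots,x_n]$, $$\mathrm{Ann}(g):=\left\{f\in k[x_1,\dots,x_n]: f\left(\frac{\partial}{\partial x_1},\dots,\frac{\partial}{\partial x_n}\right)(g)=0\right\}.$$ A polynomial $g$ with $\mathrm{Ann}(g)=J$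 is called a (Macaulay) inverse system for $A=k[x_1,\dots,x_n]/J$. *)

(* Defs.v *)
From HB Require Import structures.
From mathcomp Require Import all_boot all_order all_algebra.
From mathcomp Require Import ring_quotient generic_quotient.
From mathcomp Require Export mpoly.

Set Implicit Arguments.
Unset Strict Implicit.
Unset Printing Implicit Defensive.

Import GRing.Theory.
Local Open Scope ring_scope.
Local Open Scope quotient_scope.

(* The library equips [{ideal_quot J}] with a commutative ring structure only;
   when [R] is a [K]-algebra we add the induced [K]-algebra structure. *)
Section QuotientAlgebra.
Variables (K : nzRingType) (R : comAlgType K) (J : idealr R).
Local Notation Q := {ideal_quot J}.

Definition quot_scale (c : K) (a : Q) : Q := \pi_Q (c *: repr a).

Fact quot_scaleE c (f : R) : quot_scale c (\pi_Q f) = \pi_Q (c *: f).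
Proof.
rewrite /quot_scale; apply/eqP; rewrite -Quotient.idealrBE -scalerBr.
by rewrite -mulr_algl; apply: idealMr; rewrite Quotient.idealrBE reprK.
Qed.

Fact quot_scaleA c d (a : Q) :
  quot_scale c (quot_scale d a) = quot_scale (c * d) a.
Proof. by rewrite -[a]reprK [quot_scale d _]quot_scaleE !quot_scaleE scalerA. Qed.

Fact quot_scale1 : left_id 1 quot_scale.
Proof. by move=> a; rewrite -[a]reprK quot_scaleE scale1r. Qed.

Fact quot_scaleDr : right_distributive quot_scale +%R.
Proof.
move=> c a b; rewrite -[a]reprK -[b]reprK -pi_addr !quot_scaleE -pi_addr.
by rewrite scalerDr.
Qed.

Fact quot_scaleDl (a : Q) : {morph quot_scale^~ a : c d / c + d}.
Proof.
by move=> c d; rewrite -[a]reprK !quot_scaleE -pi_addr scalerDl.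
Qed.

HB.instance Definition _ := GRing.Zmodule_isLmodule.Build K Q
  quot_scaleA quot_scale1 quot_scaleDr quot_scaleDl.

Fact quot_scaleAl (c : K) (a b : Q) : c *: (a * b) = c *: a * b.
Proof.
change (quot_scale c (a * b) = quot_scale c a * b).
rewrite -[a]reprK -[b]reprK quot_scaleE -!pi_mulr quot_scaleE.
by rewrite scalerAl.
Qed.

HB.instance Definition _ :=
  GRing.Lmodule_isLalgebra.Build K Q quot_scaleAl.

Fact quot_scaleAr (c : K) (a b : Q) : c *: (a * b) = a * (c *: b).
Proof. by rewrite mulrC quot_scaleAl mulrC. Qed.

HB.instance Definition _ :=
  GRing.Lalgebra_isAlgebra.Build K Q quot_scaleAr.

End QuotientAlgebra.

Section LocalAlgebra.
Variable A : comNzRingType.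

Definition is_ideal (I : A -> Prop) : Prop :=
  [/\ I 0, (forall a b, I a -> I b -> I (a + b))
    & forall a b, I b -> I (a * b)].

Definition maximal_ideal (M : A -> Prop) : Prop :=
  [/\ is_ideal M, ~ M 1
    & forall I, is_ideal I -> (forall a, M a -> I a) ->
        (forall a, I a -> M a) \/ I 1].

Definition local_with (M : A -> Prop) : Prop :=
  maximal_ideal M /\
  forall M', maximal_ideal M' -> forall a, M' a <-> M a.

Definition artinian : Prop :=
  forall I : nat -> A -> Prop,
    (forall j, is_ideal (I j)) ->
    (forall j a, I j.+1 a -> I j a) ->
    exists N, forall j, (N <= j)%N -> forall a, I N a -> I j a.

Definition socle (M : A -> Prop) : A -> Prop :=
  fun a => forall b, M b -> a * b = 0.

Definition ideal_mul (I I' : A -> Prop) : A -> Prop :=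
  fun a => exists2 s : seq (A * A),
    (forall u, u \in s -> I u.1 /\ I' u.2) & a = \sum_(u <- s) u.1 * u.2.

(* [ideal_exp I 0] is the whole ring. *)
Definition ideal_exp (I : A -> Prop) (j : nat) : A -> Prop :=
  iter j (ideal_mul I) (fun=> True).

Definition socle_degree (M : A -> Prop) (eta : nat) : Prop :=
  (exists2 a, ideal_exp M eta a & a != 0) /\
  forall j, (exists2 a, ideal_exp M j a & a != 0) -> (j <= eta)%N.

End LocalAlgebra.

Definition one_dimensional (K : nzRingType) (V : lmodType K)
    (S : V -> Prop) : Prop :=
  exists2 v, v != 0 & forall w, S w <-> exists c : K, w = c *: v.

Definition gorenstein (K : nzRingType) (A : comAlgType K)
    (M : A -> Prop) : Prop :=
  one_dimensional (socle M).

(* The internal direct sum [V = S (+) T]. *)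
Definition complementary (V : zmodType) (S T : V -> Prop) : Prop :=
  (forall v, S v -> T v -> v = 0) /\
  (forall v, exists s t, [/\ S s, T t & v = s + t]).

Section InverseSystems.
Variables (k : fieldType) (n : nat).

Definition in_ideal_vars (f : {mpoly k[n]}) : Prop :=
  exists h : 'I_n -> {mpoly k[n]}, f = \sum_(i < n) h i * 'X_i.

(* [f(d/dx_1, ..., d/dx_n) (g)] *)
Definition diff_act (f g : {mpoly k[n]}) : {mpoly k[n]} :=
  \sum_(m <- msupp f) f@_m *: g^`M[m].

Definition Ann (g : {mpoly k[n]}) : {pred {mpoly k[n]}} :=
  [pred f | diff_act f g == 0].

(* The power is taken in [A[x_1, ..., x_n]], and [rho] is then applied to the
   coefficients. *)
Definition exp_poly (A : comAlgType k) (e : 'I_n -> A) (rho : A -> k)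
    (eta : nat) : {mpoly k[n]} :=
  \sum_(j < eta.+1)
    (j`!%:R)^-1 *: map_mpoly rho ((\sum_(i < n) e i *: 'X_i) ^+ j).

End InverseSystems.

(* Main.v *)
(** Put [L = x_1 e_1 + ... + x_n e_n] and, for [a] in [A],
    [R_a = sum_(j <= eta) rho (a L^j) / j!], so that [R = R_1].  Since
    [dL/dx_i = e_i] and [m^(eta+1) = 0], one has [dR_a/dx_i = R_(a e_i)], hence
    [f(d/dx) R = R_(f(e))].  Differentiating further and taking constant terms,
    [R_b = 0] forces [rho] to vanish on all monomial multiples of [b].  If
    [b <> 0], a nonzero such multiple of maximal degree lies in the socle, on
    which [rho] has no nonzero zero; hence [R_b = 0] only for [b = 0].
    The socle is computed with [m = (e_1, ..., e_n)]: since [J] is contained in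
    [(x_1, ..., x_n)], [(e_1, ..., e_n)] is a maximal ideal of the local ring [A]. *)

Require Import Defs.
From Stdlib Require Import Classical_Prop.
From HB Require Import structures.
From mathcomp Require Import all_boot all_order all_algebra.
From mathcomp Require Import ring_quotient generic_quotient mpoly.

Import GRing.Theory.
Local Open Scope ring_scope.
Local Open Scope quotient_scope.

Set Implicit Arguments.
Unset Strict Implicit.
Unset Printing Implicit Defensive.

Section Ideals.
Variable A : comNzRingType.
Implicit Types (I : A -> Prop) (a b : A).

Lemma ideal_exp0 I j : ideal_exp I j 0.
Proof. by case: j => [|j] //=; exists [::] => //; rewrite big_nil. Qed.

Lemma ideal_expD I j a b :
  ideal_exp I j a -> ideal_exp I j b -> ideal_exp I j (a + b).
Proof.
case: j => [|j] //= [s Hs ->] [t Ht ->]; exists (s ++ t).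
  by move=> u; rewrite mem_cat => /orP[]; [apply: Hs | apply: Ht].
by rewrite big_cat.
Qed.

Lemma ideal_expS I j a b : I a -> ideal_exp I j b -> ideal_exp I j.+1 (a * b).
Proof.
move=> Ia Ib; exists [:: (a, b)]; last by rewrite big_seq1.
by move=> u; rewrite inE => /eqP ->.
Qed.

(** Each coefficient of [p * p ^+ j] is a sum of products of a coefficient of [p] and one of
    [p ^+ j]. Applied to [L], this brings the powers of the maximal ideal into play. *)
Lemma mcoeff_exp_ideal n I (p : {mpoly A[n]}) j :
  (forall m, I p@_m) -> forall m, ideal_exp I j (p ^+ j)@_m.
Proof.
move=> Ip; elim: j => [|j IHj] m //; rewrite exprS mcoeffM.
apply: big_ind => [||c _]; [exact: ideal_exp0 | exact: ideal_expD |].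
exact: ideal_expS.
Qed.

Lemma ideal_sum I (T : Type) (r : seq T) (F : T -> A) :
  is_ideal I -> (forall i, I (F i)) -> I (\sum_(i <- r) F i).
Proof. by case=> I0 ID _ IF; apply: big_ind. Qed.

End Ideals.

(** Induction on the total degree: a monomial of positive degree is divisible by some variable. *)
Lemma mnm_ind n (P : 'X_{1..n} -> Prop) :
  P 0%MM -> (forall i m, P m -> P (m + U_(i))%MM) -> forall m, P m.
Proof.
move=> P0 PS m; elim: {m}(mdeg m) {-2}m (erefl (mdeg m)) => [|d IHd] m.
  by move/eqP; rewrite mdeg_eq0 => /eqP ->.
move=> md; have [i mi] : exists i, m i != 0%N.
  apply/existsP; apply: contraT; rewrite negb_exists => /forallP m0.
  suff m_eq0 : m = 0%MM by rewrite m_eq0 mdeg0 in md.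
  by apply/mnmP => i; rewrite mnm0E; apply/eqP; rewrite -[_ == _]negbK m0.
have le_im : (U_(i) <= m)%MM by rewrite lep1mP.
rewrite -(submK le_im); apply/PS/IHd/eqP.
by rewrite -eqSS -md -{2}(submK le_im) mdegD mdeg1 addn1.
Qed.

Lemma mderivXn n (A : comNzRingType) (i : 'I_n) (p : {mpoly A[n]}) j :
  (p ^+ j.+1)^`M(i) = (p^`M(i) * p ^+ j) *+ j.+1.
Proof.
elim: j => [|j IHj]; first by rewrite expr1 expr0 mulr1.
by rewrite exprS mderivM IHj mulrnAr mulrCA -exprS [in RHS]mulrS.
Qed.

Lemma mderiv_map n (A B : nzRingType) (h : {additive A -> B}) (i : 'I_n)
    (p : {mpoly A[n]}) :
  (map_mpoly h p)^`M(i) = map_mpoly h p^`M(i).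
Proof.
by apply/mpolyP => m; rewrite mcoeff_deriv !mcoeff_map_mpoly mcoeff_deriv raddfMn.
Qed.

Section VariableIdeal.
Variables (k : fieldType) (n : nat).

Lemma in_ideal_vars_ideal : is_ideal (@in_ideal_vars k n).
Proof.
split=> [|f g [hf ->] [hg ->]|f g [h ->]].
- by exists (fun=> 0); rewrite big1 // => i _; rewrite mul0r.
- exists (fun i => hf i + hg i); rewrite -big_split.
  by apply: eq_bigr => i _; rewrite mulrDl.
- exists (fun i => f * h i); rewrite mulr_sumr.
  by apply: eq_bigr => i _; rewrite mulrA.
Qed.

Lemma in_ideal_varsX i : in_ideal_vars ('X_i : {mpoly k[n]}).
Proof.
exists (fun j => (j == i)%:R); rewrite (bigD1 i) //= eqxx mul1r big1 ?addr0 //.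
by move=> j /negPf ->; rewrite mul0r.
Qed.

Lemma in_ideal_vars_mcoeff0 (f : {mpoly k[n]}) : in_ideal_vars f -> f@_0 = 0.
Proof.
case=> h ->; rewrite raddf_sum big1 // => i _.
by rewrite /= rmorphM /= mcoeffX -mdeg_eq0 mdeg1 mulr0.
Qed.

(** By linearity it suffices to treat monomials: such a monomial is either 1 or has a variable as a
    factor and zero constant term. This is the source of the maximality of the ideal of the
    variables. *)
Lemma in_ideal_vars_subC (f : {mpoly k[n]}) : in_ideal_vars (f - (f@_0)%:MP).
Proof.
have [I0 ID IM] := in_ideal_vars_ideal.
elim/mpolyind: f => [|c m f _ _ IHf]; first by rewrite mcoeff0 mpolyC0 subr0.
rewrite mcoeffD mpolyCD opprD addrACA; apply: ID => //.
rewrite mcoeffZ mpolyCM -mul_mpolyC -mulrBr; apply: (IM).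
elim/mnm_ind: m => [|i m _]; first by rewrite mpolyX0 mcoeff1 eqxx subrr.
rewrite mcoeffX -mdeg_eq0 mdegD mdeg1 addn1 mpolyC0 subr0 mpolyXD.
exact/IM/in_ideal_varsX.
Qed.

End VariableIdeal.

Section ExpPoly.
Variables (k : fieldType) (n : nat) (A : comAlgType k) (e : 'I_n -> A).
Variables (rho : {scalar A}) (eta : nat).
Hypothesis k_char0 : [pchar k] =i pred0.

Local Notation L := (\sum_(i < n) e i *: 'X_i).

(** This is [R_a]; letting [a] vary makes the family closed under differentiation. *)
Definition twisted_exp_poly (a : A) : {mpoly k[n]} :=
  \sum_(j < eta.+1) (j`!%:R)^-1 *: map_mpoly rho (a *: L ^+ j).

Lemma exp_polyE : exp_poly e rho eta = twisted_exp_poly 1.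
Proof. by apply: eq_bigr => j _; rewrite scale1r. Qed.

Lemma twisted_exp_poly_is_linear : linear twisted_exp_poly.
Proof.
move=> c a b; rewrite /twisted_exp_poly scaler_sumr -big_split /=.
apply: eq_bigr => j _; apply/mpolyP => m.
rewrite mcoeffD !mcoeffZ !mcoeff_map_mpoly !mcoeffZ mulrDl -scalerAl.
by rewrite /= linearP mulrDr mulrCA.
Qed.

HB.instance Definition _ := GRing.isLinear.Build k A {mpoly k[n]} _
  twisted_exp_poly twisted_exp_poly_is_linear.

Lemma mcoeff_linear_form m :
  L@_m = \sum_(i < n) e i * (U_(i)%MM == m)%:R.
Proof. by rewrite raddf_sum; apply: eq_bigr => i _; rewrite /= mcoeffZ mcoeffX. Qed.

Lemma mderiv_linear_form i : L^`M(i) = (e i)%:MP.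
Proof.
apply/mpolyP => m; rewrite mcoeff_deriv mcoeff_linear_form mcoeffC.
rewrite (bigD1 i) //= big1 => [|j ji]; last first.
  (* The two exponents differ at [i]: zero on the left, positive on the right. *)
  rewrite (_ : (_ == _) = false) ?mulr0 //; apply/negP => /eqP/mnmP/(_ i).
  by rewrite mnmDE !mnmE (negPf ji) eqxx addn1.
rewrite addr0; have -> : (U_(i) == m + U_(i))%MM = (m == 0%MM).
  by rewrite -{1}[U_(i)%MM]add0m eqm_add2r eq_sym.
by case: eqP => [->|_]; rewrite ?mulr0 ?mul0rn // mnm0E.
Qed.

(** Only [j = 0] contributes, because [L] has no constant term. *)
Lemma mcoeff0_twisted_exp_poly a : (twisted_exp_poly a)@_0 = rho a.
Proof.
rewrite raddf_sum big_ord_recl /= [X in _ + X]big1 => [|j _]; last first.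
  rewrite mcoeffZ mcoeff_map_mpoly mcoeffZ rmorphXn /= mcoeff_linear_form big1.
    by rewrite expr0n mulr0 raddf0 mulr0.
  by move=> i _; rewrite -mdeg_eq0 mdeg1 mulr0.
by rewrite addr0 mcoeffZ mcoeff_map_mpoly mcoeffZ mcoeff1 eqxx mulr1 invr1 mul1r.
Qed.

Hypothesis L_nilp : forall i, e i *: L ^+ eta = 0.

Lemma mderiv_twisted_exp_poly a i :
  (twisted_exp_poly a)^`M(i) = twisted_exp_poly (a * e i).
Proof.
rewrite raddf_sum big_ord_recl /= expr0 mderivZ mderiv_map mderivZ -mpolyC1.
rewrite mderivC scaler0 raddf0 scaler0 add0r /twisted_exp_poly big_ord_recr /=.
(* The derivative has no term in [L ^+ eta]; the top term of the right-hand side is zero by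
   [L_nilp], so the two sums match after the index shift. *)
rewrite -scalerA L_nilp scaler0 raddf0 scaler0 addr0; apply: eq_bigr => j _.
rewrite mderivZ mderiv_map mderivZ mderivXn mderiv_linear_form mul_mpolyC.
rewrite -scalerMnr raddfMn /= -scalerMnr scalerMnl scalerA; congr (_ *: _).
(* Characteristic zero lets the factor [j.+1] from differentiating [L ^+ j.+1] turn the inverse of
   [j.+1]! into that of [j]!. *)
have j_neq0 : (j.+1%:R : k) != 0 by rewrite (pcharf0P k).1.
by rewrite factS natrM invfM -mulr_natl mulrA divff // mul1r.
Qed.

Variable pi : {rmorphism {mpoly k[n]} -> A}.
Hypotheses (piX : forall i, pi 'X_i = e i) (piZ : scalable pi).

Lemma mderivm_twisted_exp_poly m a :
  (twisted_exp_poly a)^`M[m] = twisted_exp_poly (a * pi 'X_[m]).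
Proof.
elim/mnm_ind: m a => [|i m IHm] a.
  by rewrite mderivm0m mpolyX0 rmorph1 mulr1.
rewrite addmC mderivmDm mderivmU1m mderiv_twisted_exp_poly IHm mpolyXD.
by rewrite rmorphM /= piX mulrA.
Qed.

Lemma diff_act_twisted_exp_poly f a :
  diff_act f (twisted_exp_poly a) = twisted_exp_poly (a * pi f).
Proof.
rewrite /diff_act {3}[f]mpolyE raddf_sum mulr_sumr raddf_sum.
apply: eq_bigr => m _; rewrite mderivm_twisted_exp_poly -linearZ /=.
by rewrite piZ scalerAr.
Qed.

Lemma twisted_exp_poly_eq0 b m :
  twisted_exp_poly b = 0 -> rho (b * pi 'X_[m]) = 0.
Proof.
move=> Rb0; rewrite -mcoeff0_twisted_exp_poly -mderivm_twisted_exp_poly Rb0.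
by rewrite !raddf0.
Qed.

End ExpPoly.

Lemma local_ideal_vars (k : fieldType) n (J : idealr {mpoly k[n]})
    (hJ : forall f : {mpoly k[n]}, f \in J -> in_ideal_vars f)
    (M : {ideal_quot J} -> Prop) (hlocal : local_with M) (a : {ideal_quot J}) :
  M a <-> exists2 f, in_ideal_vars f & a = \pi f.
Proof.
have [I0 ID IM] := in_ideal_vars_ideal k n.
apply: iff_sym; move: a; apply: hlocal.2; split.
- split=> [|a b [f If ->] [g Ig ->]|a b [f If ->]].
  + by exists 0 => //; rewrite rmorph0.
  + by exists (f + g); [exact: ID | rewrite rmorphD].
  + by exists (repr a * f); [exact: IM | rewrite rmorphM /= reprK].
(* Properness: if [1 - f] were in [J], its constant term 1 would vanish. *)
- case=> f If; rewrite -(rmorph1 (\pi_{ideal_quot J})) => /eqP.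
  rewrite -Quotient.idealrBE => /hJ/in_ideal_vars_mcoeff0/eqP.
  by rewrite mcoeffB mcoeff1 eqxx (in_ideal_vars_mcoeff0 If) subr0 oner_eq0.
- move=> I [_ JD JM] sNI.
  case: (classic (I 1)) => [|nI1]; [by right | left=> a Ia].
  exists (repr a); last by rewrite reprK.
  have := in_ideal_vars_subC (repr a).
  case: (eqVneq (repr a)@_0 0) => [->|a0 Ia0]; first by rewrite mpolyC0 subr0.
  case: nI1; set c := _@_0 in a0 Ia0.
  (* Removing from [a] its part without constant term leaves the nonzero scalar [c], which is a
     unit. *)
  have -> : 1 = \pi_{ideal_quot J} c^-1%:MP *
      (a + -1 * \pi_{ideal_quot J} (repr a - c%:MP)).
    rewrite mulN1r -{1}[a]reprK -rmorphB /= subKr -rmorphM /=.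
    by rewrite -mpolyCM mulVf // rmorph1.
  by apply/JM/JD => //; apply/JM/sNI; exists (repr a - c%:MP).
Qed.

Theorem proposition3p2 (k : fieldType) (hk : [pchar k] =i pred0) (n : nat)
    (J : idealr {mpoly k[n]})
    (hJ : forall f : {mpoly k[n]}, f \in J -> in_ideal_vars f)
    (M : {ideal_quot J} -> Prop) (hlocal : local_with M)
    (hart : artinian {ideal_quot J})
    (hgor : gorenstein M)
    (eta : nat) (heta : socle_degree M eta)
    (rho : {scalar {ideal_quot J}})
    (hrho : complementary (fun a => rho a = 0) (socle M)) :
  let e := fun i : 'I_n => \pi_{ideal_quot J} 'X_i in
  let R := exp_poly e rho eta in
  Ann R =i J.
Proof.
move=> e R f.
have ME := local_ideal_vars hJ hlocal.
have Me i : M (e i) by apply/ME; exists 'X_i => //; exact: in_ideal_varsX.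
have expM_eq0 j a : (eta < j)%N -> ideal_exp M j a -> a = 0.
  move=> lt_j Ma; apply/eqP; apply: contraLR lt_j => a0; rewrite -leqNgt.
  by apply: heta.2; exists a.
have idM : is_ideal M by case: hlocal => [[]].
have ML m : M (\sum_(i < n) e i *: 'X_i)@_m.
  rewrite mcoeff_linear_form; apply: ideal_sum => // i.
  by rewrite mulrC; case: idM => _ _; apply.
have L_nilp i : e i *: (\sum_(i < n) e i *: 'X_i) ^+ eta = 0.
  apply/mpolyP => m; rewrite mcoeffZ mcoeff0; apply: (expM_eq0 eta.+1) => //.
  exact/ideal_expS/mcoeff_exp_ideal.
have piZ : scalable \pi_{ideal_quot J} by move=> c g; rewrite /= -quot_scaleE.
have piX i : \pi_{ideal_quot J} 'X_i = e i by [].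
have memJ : (f \in J) = (\pi_{ideal_quot J} f == 0).
  by rewrite -[f in LHS]subr0 Quotient.idealrBE rmorph0.
have R_diff : diff_act f R = twisted_exp_poly e rho eta (\pi f).
  by rewrite /R exp_polyE (diff_act_twisted_exp_poly rho hk L_nilp piX piZ) mul1r.
rewrite inE R_diff memJ; apply/eqP/eqP => [Rf0|->]; last exact: raddf0.
set b := \pi f in Rf0 *.
have rho0 m := twisted_exp_poly_eq0 hk L_nilp piX m Rf0.
have expM_mon m : ideal_exp M (mdeg m) (\pi_{ideal_quot J} 'X_[m]).
  elim/mnm_ind: m => [|i m IHm]; first by rewrite mdeg0.
  rewrite mdegD mdeg1 addn1 addmC mpolyXD rmorphM.
  exact: ideal_expS (Me i) IHm.
(* Descending induction on the degree of [m], with [d] bounding its distance to [eta.+1]; the case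
   of the monomial 1 gives [b = 0]. *)
suff mon0 d m : (eta < mdeg m + d)%N -> b * \pi 'X_[m] = 0.
  have := mon0 eta.+1 0%MM; rewrite mdeg0 mpolyX0 rmorph1 mulr1; exact.
elim: d m => [|d IHd] m lt_m.
  by rewrite (expM_eq0 (mdeg m) (\pi 'X_[m])) ?mulr0 // -[mdeg m]addn0.
(* The product is in the kernel of [rho] by [rho0]. It is in the socle because multiplying by any
   [e i] raises the degree, where [IHd] gives zero. *)
apply: hrho.1 => [|_ /ME[_ [h ->] ->]]; first exact: rho0.
rewrite rmorph_sum mulr_sumr big1 // => i _; rewrite rmorphM /= mulrCA -mulrA.
by rewrite -rmorphM -mpolyXD IHd ?mulr0 // mdegD mdeg1 addn1 addSnnS.
Qed.
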